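(* There exists a Tonelli Hamiltonian $H:\mathbb{T}\times\mathbb{R}\to\mathbb{R}$ such that, with $G:=-H$, for every Lipschitz initial datum $u_0:\mathbb{T}\to\mathbb{R}$ the multi-time Hamilton--Jacobi equation $$ \begin{cases} \partial_t u+H(x,D_xu)=0 & \text{in }(0,+\infty)\times(0,+\infty)\times\mathbb{T},\\ \partial_s u+G(x,D_xu)=0 & \text{in }(0,+\infty)\times(0,+\infty)\times\mathbb{T},\\ u(0,0,x)=u_0(x) & \text{on }\mathbb{T}, \end{cases} $$ does not admit viscosity solutions.
   Context: $\mathbb{T}$ is the flat one-dimensional torus, with cotangent bundle $\mathbb{T}\times\mathbb{R}$. A function $H:\mathbb{T}\times\mathbb{R}\to\mathbb{R}$ is a Tonelli Hamiltonian if it is of class $C^2$, $H(x,p)/|p|\to+\infty$ as $|p|\to\infty$, and $\partial^2_{pp}H$ is everywhere positive definite. Viscosity solutions: a continuous function $u$ on an open set is a viscosity subsolution (resp. supersolution) of $\partial_tu+H(x,D_xu)=0$ if for every $C^1$ function $\varphi$ such that $u-\varphi$ has a local maximum (resp. local minimum) at a point of the open set, one has $\partial_t\varphi+H(x,D_x\varphi)\le0$ (resp. $\ge0$) at that point; it is a viscosity solution if it is both. The same definition applies to $\partial_su+G(x,D_xu)=0$. A viscosity solution of the multi-time equation is a continuous function $u(t,s,x)$ on $[0,+\infty)\times[0,+\infty)\times\mathbb{T}$ that is a viscosity solution of both equations in $(0,+\infty)\times(0,+\infty)\times\mathbb{T}$ and satisfies the initial condition. *)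

(* Defs.v *)
From HB Require Import structures.
From mathcomp Require Import all_boot all_order all_algebra.
From mathcomp Require Import all_classical all_reals all_analysis.
Set Implicit Arguments.
Unset Strict Implicit.
Unset Printing Implicit Defensive.
Import Order.TTheory GRing.Theory Num.Theory.
Import numFieldNormedType.Exports.
Local Open Scope classical_set_scope.
Local Open Scope ring_scope.

(* The torus is R/Z, and functions on it are 1-periodic functions on R.  The
   metric on R/Z is locally that of R, so continuity, differentiability, local
   extrema, and the Lipschitz property (with the same constant) are those of
   the lift. *)

Section Smoothness.
Variables (R : realType) (V : normedModType R).

(* Only used for V = R^2 and R^3, where continuity of every directional
   derivative is continuity of the differential. *)
Definition C1_on (D : set V) (f : V -> R) : Prop :=
  (forall z, D z -> differentiable f z) /\
  (forall v z, D z -> {for z, continuous (fun y => 'D_v f y)}).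

Definition C2_on (D : set V) (f : V -> R) : Prop :=
  C1_on D f /\ forall v, C1_on D (fun y => 'D_v f y).

End Smoothness.

Section Tonelli.
Variable R : realType.

(* H is a function of (x, p); the limit at infinity is uniform in x. *)
Definition tonelli (H : R * R -> R) : Prop :=
  [/\ periodic H (1, 0),
      C2_on setT H,
      (forall M : R, exists A : R, forall x p : R,
          A < `|p| -> M < H (x, p) / `|p|) &
      (forall x p : R, 0 < derive1n 2 (fun q : R => H (x, q)) p)].

End Tonelli.

Section Viscosity.
Variable R : realType.

(* Points are ((t, s), x), with x the torus variable. *)
Notation space := (R * R * R)%type.

Definition open_domain : set space := [set z | 0 < z.1.1 /\ 0 < z.1.2].
Definition closed_domain : set space := [set z | 0 <= z.1.1 /\ 0 <= z.1.2].

Definition dir_t : space := (1, 0, 0).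
Definition dir_s : space := (0, 1, 0).
Definition dir_x : space := (0, 0, 1).

Definition periodic_on (D : set space) (f : space -> R) : Prop :=
  forall z, D z -> f (z + dir_x) = f z.

Definition local_max (f : space -> R) (z : space) : Prop :=
  \forall y \near z, f y <= f z.
Definition local_min (f : space -> R) (z : space) : Prop :=
  \forall y \near z, f z <= f y.

(* The equation is D_e u + F(x, D_x u) = 0 on the open set D, the direction e
   being dir_t or dir_s. *)
Definition viscosity_subsolution (D : set space) (e : space)
    (F : R * R -> R) (u : space -> R) : Prop :=
  (forall z, D z -> {for z, continuous u}) /\
  forall phi : space -> R, periodic_on D phi -> C1_on D phi ->
  forall z, D z -> local_max (fun y => u y - phi y) z ->
  'D_e phi z + F (z.2, 'D_dir_x phi z) <= 0.

Definition viscosity_supersolution (D : set space) (e : space)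
    (F : R * R -> R) (u : space -> R) : Prop :=
  (forall z, D z -> {for z, continuous u}) /\
  forall phi : space -> R, periodic_on D phi -> C1_on D phi ->
  forall z, D z -> local_min (fun y => u y - phi y) z ->
  0 <= 'D_e phi z + F (z.2, 'D_dir_x phi z).

Definition viscosity_solution (D : set space) (e : space)
    (F : R * R -> R) (u : space -> R) : Prop :=
  viscosity_subsolution D e F u /\ viscosity_supersolution D e F u.

(* The values of u outside closed_domain are irrelevant. *)
Definition multi_time_solution (H G : R * R -> R) (u0 : R -> R)
    (u : space -> R) : Prop :=
  [/\ periodic_on closed_domain u,
      {within closed_domain, continuous u},
      viscosity_solution open_domain dir_t H u,
      viscosity_solution open_domain dir_s G u &
      forall x : R, u (0, 0, x) = u0 x].

End Viscosity.

(* Main.v *)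
(* Take H(x, p) = p^2 - sin(pi x)^2, the pendulum.  Its critical value is 0, but
   H(x, Du) = 0 has no C^1 periodic solution, and this is what rules out u.

   A C^1 function touching a solution u from above (or from below) can be used
   in both equations.  Adding the two inequalities shows that u is a viscosity
   solution of u_t + u_s = 0, hence u(t, s, x) = w(t - s, x), and w then satisfies
   w_t + H(x, w_x) = 0, with equality, at every touching point.

   Put A_k(t) = max_x (w(t, x) - k x^2).  At a maximum point y, touching gives
   A_k' = sin(pi y)^2 - 4 k^2 y^2.  Hence A_0 is nondecreasing and A_2 is
   nonincreasing.  If A_2(t0) < A_0(t1) for some t0 and t1, then the maximum points
   of w(t, .) stay away from the integers for large t, so A_0 grows linearly, which
   contradicts A_0 <= A_2 + 1/2.  So A_2(t0) >= A_0(t1) for all t0 and t1;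
   taking t0 = t1 puts the maximum of w(t, .) at x = 0, with a value independent
   of t.

   Since - u(s, t, x) solves the same system, the minimum is at x = 0 too.
   Thus w is constant, although H(1/2, 0) = -1. *)
Require Import Defs.
From HB Require Import structures.
From mathcomp Require Import ring lra.
From mathcomp Require Import all_boot all_order all_algebra.
From mathcomp Require Import all_classical all_reals all_analysis.
Set Implicit Arguments.
Unset Strict Implicit.
Unset Printing Implicit Defensive.
Import Order.TTheory GRing.Theory Num.Theory.
Import numFieldNormedType.Exports.
Local Open Scope classical_set_scope.
Local Open Scope ring_scope.

(** * Symbolic calculus for smooth functions *)

Section SmoothExpressions.
Variables (R : realType) (V : normedModType R).

(* Syntax for smooth functions: the derivatives needed for [C1_on], [C2_on] and
   for the test functions are then computed symbolically. *)
Inductive expr : Type :=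
| Const of R
| Lin (f : {linear V -> R}) of continuous f
| Add of expr & expr
| Mul of expr & expr
| Sin of expr
| Cos of expr.

Fixpoint expr_eval (e : expr) (z : V) : R :=
  match e with
  | Const c => c
  | Lin f _ => f z
  | Add a b => expr_eval a z + expr_eval b z
  | Mul a b => expr_eval a z * expr_eval b z
  | Sin a => sin (expr_eval a z)
  | Cos a => cos (expr_eval a z)
  end.

Fixpoint expr_deriv (v : V) (e : expr) : expr :=
  match e with
  | Const _ => Const 0
  | Lin f _ => Const (f v)
  | Add a b => Add (expr_deriv v a) (expr_deriv v b)
  | Mul a b => Add (Mul (expr_deriv v a) b) (Mul a (expr_deriv v b))
  | Sin a => Mul (Cos a) (expr_deriv v a)
  | Cos a => Mul (Mul (Const (-1)) (Sin a)) (expr_deriv v a)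
  end.

Lemma differentiable_expr (e : expr) (z : V) : differentiable (expr_eval e) z.
Proof.
elim: e => [c|f cf|a da b db|a da b db|a da|a da] /=.
- exact: differentiable_cst.
- exact: linear_differentiable.
- exact: differentiableD.
- exact: differentiableM.
- by apply: (@differentiable_comp _ _ _ _ (expr_eval a) sin) => //; apply/derivable1_diffP.
- by apply: (@differentiable_comp _ _ _ _ (expr_eval a) cos) => //; apply/derivable1_diffP.
Qed.

Lemma derive_compR (g : R -> R) (f : V -> R) (v z : V) :
  differentiable f z -> derivable g (f z) 1 ->
  'D_v (g \o f) z = 'D_1 g (f z) * 'D_v f z.
Proof.
move=> df /derivable1_diffP dg.
rewrite deriveE; last exact: differentiable_comp.
rewrite diff_comp //= (deriveE _ dg) (deriveE _ df).
by rewrite -[X in 'd g _ X]mulr1 [LHS]linearZ /= mulrC.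
Qed.

Lemma derive_expr (e : expr) (v z : V) : 'D_v (expr_eval e) z = expr_eval (expr_deriv v e) z.
Proof.
elim: e => [c|f cf|a da b db|a da b db|a da|a da] /=.
- exact: derive_cst.
- by rewrite deriveE ?diff_lin //; exact: linear_differentiable.
- have h e : derivable (expr_eval e) z v by apply/diff_derivable/differentiable_expr.
  by rewrite -da -db -deriveD.
- have h e : derivable (expr_eval e) z v by apply/diff_derivable/differentiable_expr.
  by rewrite -da -db (deriveM (h a) (h b)) /GRing.scale /=; ring.
- rewrite (derive_compR _ (differentiable_expr a z)) //.
  by rewrite derive_val da.
- rewrite (derive_compR _ (differentiable_expr a z)) //.
  by rewrite derive_val da mulN1r.
Qed.

Lemma C1_expr (A : set V) (e : expr) : C1_on A (expr_eval e).
Proof.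
split=> [z _|v z _]; first exact: differentiable_expr.
rewrite (_ : (fun y => _) = expr_eval (expr_deriv v e)); last first.
  by apply/funext=> y; exact: derive_expr.
exact/differentiable_continuous/differentiable_expr.
Qed.

Lemma C2_expr (A : set V) (e : expr) : C2_on A (expr_eval e).
Proof.
split=> [|v]; first exact: C1_expr.
rewrite (_ : (fun y => _) = expr_eval (expr_deriv v e)); last first.
  by apply/funext=> y; exact: derive_expr.
exact: C1_expr.
Qed.

End SmoothExpressions.

(** * Elementary estimates for sine and cosine *)

Section Trig.
Variable R : realType.
Implicit Types x y z : R.

Lemma sin_lipschitz x y : `|sin x - sin y| <= `|x - y|.
Proof.
wlog xy : x y / x <= y => [h|].
  case/orP: (le_total x y) => [/h//|/h]; by rewrite distrC [leRHS]distrC.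
have [|c _ h] := @MVT_segment R sin cos x y xy (fun z _ => is_derive_sin z).
  by apply: continuous_subspaceT => z; exact: continuous_sin.
rewrite distrC h normrM [leRHS]distrC ler_piMl //; exact: cos_max.
Qed.

Lemma cos_near1 z : `|1 - cos z| <= `|z|.
Proof.
have -> : 1 - cos z = 2 * sin (z / 2) ^+ 2.
  rewrite [z in cos z](_ : _ = (z / 2) *+ 2); last by rewrite -mulr_natr; field.
  by rewrite cos_mulr2n cos2sin2; ring.
have := sin_lipschitz (z / 2) 0; rewrite sin0 !subr0 => h.
have h1 := sin_max (z / 2).
rewrite normrM normrX normr_nat.
have -> : `|z| = 2 * `|z / 2| by rewrite normrM [`|2^-1|]gtr0_norm //; field.
rewrite ler_pM2l // expr2; apply: (le_trans _ h); exact: ler_piMl.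
Qed.

Lemma sin_near_id z : `|sin z - z| <= z ^+ 2.
Proof.
wlog z0 : z / 0 <= z => [h|].
  case/orP: (le_total 0 z) => [/h//|z0].
  by have := h (- z); rewrite oppr_ge0 sinN sqrrN -opprD normrN; exact.
have d x : x \in `]0, z[ -> is_derive x 1 (fun x => sin x - x) (cos x - 1).
  by move=> _; apply: is_deriveB.
have [|c + h] := MVT_segment z0 d.
  apply: continuous_subspaceT => x.
  by apply: continuousB; [exact: continuous_sin|exact: cvg_id].
rewrite in_itv /= => /andP[c0 cz].
move: h; rewrite sin0 !subr0 => ->.
rewrite normrM (ger0_norm z0) expr2 ler_wpM2r // distrC.
by apply: (le_trans (cos_near1 c)); rewrite ger0_norm.
Qed.

(** On [0, 1/2] the function sin(pi y) increases, so its square is smallest at the least admissible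
    [|y|]. This supplies the rate of linear growth in [slice_le_parabola_max]. *)
Lemma sin_sqr_bounded_below (e : R) : 0 < e -> exists2 eta, 0 < eta &
  forall y, `|y| <= 1 / 2 -> e <= y ^+ 2 -> eta <= sin (pi * y) ^+ 2.
Proof.
move=> e0; have pi0 := pi_gt0 R.
pose d := Num.min (Num.sqrt e) (1 / 2).
have d0 : 0 < d by rewrite lt_min sqrtr_gt0 e0; lra.
have d1 : d <= 1 / 2 by rewrite ge_min lexx orbT.
have s0 : 0 < sin (pi * d).
  apply: sin_gt0_pi; apply/andP; split; first exact: mulr_gt0.
  by rewrite gtr_pMr //; lra.
exists (sin (pi * d) ^+ 2); first exact: exprn_gt0.
move=> y yC ey.
have dy : d <= `|y|.
  by rewrite ge_min -sqrtr_sqr ler_wsqrtr.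
have -> : sin (pi * y) ^+ 2 = sin (pi * `|y|) ^+ 2.
  have [y0|y0] := leP 0 y; first by rewrite ger0_norm.
  by rewrite ltr0_norm // mulrN sinN sqrrN.
have mono : sin (pi * d) <= sin (pi * `|y|).
  have in_mono (z : R) : 0 <= z <= 1 / 2 -> pi * z \in `[- (pi / 2), pi / 2].
    move=> /andP[z0 z1]; rewrite in_itv /=.
    have := mulr_ge0 (ltW pi0) z0; have := ler_wpM2l (ltW pi0) z1; lra.
  move: dy; rewrite le_eqVlt => /predU1P[->//|dy]; apply: ltW.
  by rewrite ltr_sin ?ltr_pM2l //; apply: in_mono; rewrite ?(ltW d0) ?normr_ge0.
by apply: lerXn2r => //; rewrite nnegrE ltW // (lt_le_trans s0).
Qed.

End Trig.

(** * Monotonicity of maxima from one-sided touching *)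

Section Monotonicity.
Variable R : realType.

(** The squared positive part has second derivative at most 2, hence lies below its tangent
    parabolas. The penalty in [touch_monotone] can thus be replaced by a quadratic. *)
Lemma sqr_pos_part_touch (c y : R) :
  (Num.max 0 y) ^+ 2 <=
    (Num.max 0 c) ^+ 2 + 2 * Num.max 0 c * (y - c) + (y - c) ^+ 2.
Proof.
have [y0|y0] := leP y 0; have [c0|c0] := leP c 0; rewrite ?expr0n /=; try nra.
by rewrite mulr0 mul0r !add0r sqr_ge0.
Qed.

Section CompactParameter.
Variables (T : topologicalType) (C : set T) (f : R * T -> R) (a0 b0 : R).
Hypothesis compact_C : compact C.
Hypothesis continuous_f :
  forall c y, a0 < c < b0 -> C y -> {for (c, y), continuous f}.

(** The case [a = b] is used too: it gives a maximum over [C] at one fixed time. *)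
Lemma exists_max_rectangle (a b : R) (x : T) (g : R -> R) :
  a0 < a -> a <= b -> b < b0 -> C x -> continuous g ->
  exists c y, [/\ a <= c <= b, C y &
    forall r z, a <= r <= b -> C z -> f (r, z) - g r <= f (c, y) - g c].
Proof.
move=> a0a ab bb0 Cx cg.
have ne : `[a, b] `*` C !=set0 by exists (a, x); split => //=; rewrite in_itv /= lexx.
have cpt := compact_setX (@segment_compact _ a b) compact_C.
have [|[c y] + h] := @compact_EVT_max _ _ (fun z => f z - g z.1) _ ne cpt.
  apply: continuous_in_subspaceT => -[c y]; rewrite inE => -[/= + Cy].
  rewrite in_itv /= => /andP[ac cb].
  apply: continuousB; first by apply: continuous_f => //; lra.
  by apply: (continuous_comp (f := fst) (g := g)); [exact: cvg_fst|exact: cg].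
rewrite inE => -[/= + Cy]; rewrite in_itv /= => acb.
exists c, y; split => // r z arb Cz.
by apply: (h (r, z)); rewrite inE; split; rewrite //= in_itv.
Qed.

(* One-variable comparison for the function [max_(y in C) f (r, y)]. *)
Lemma touch_monotone (eta : R) :
  (forall c y q K d, a0 < c < b0 -> C y -> 0 < d -> 0 <= K ->
     (forall r z, `|r - c| < d -> C z ->
        f (r, z) <= f (c, y) + q * (r - c) + K * (r - c) ^+ 2) -> q <= eta) ->
  forall a b x, a0 < a -> a <= b -> b < b0 -> C x ->
    exists2 y, C y & f (b, x) <= f (a, y) + eta * (b - a).
Proof.
move=> touch a b x a0a ab bb0 Cx.
have [c [y [cE Cy ymax]]] :=
  @exists_max_rectangle a a x (fun=> 0) a0a (lexx a) ltac:(lra) Cx (@cst_continuous _ _ _).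
have ca : c = a by lra.
exists y => //; have {}ymax z : C z -> f (a, z) <= f (a, y).
  by move=> Cz; have := ymax a z; rewrite ca !subr0 lexx => /(_ erefl Cz).
move: ab; rewrite le_eqVlt => /predU1P[<-|ab].
  by rewrite subrr mulr0 addr0; exact: ymax.
apply/ler_addgt0Pr => e e0.
(* A slope strictly above [eta] leaves room for a contradiction at an interior maximum. *)
pose s := eta + e / (b - a).
have -> : f (a, y) + eta * (b - a) + e = f (a, y) + s * (b - a).
  by rewrite /s; field; lra.
have es : eta < s by rewrite ltrDl divr_gt0 // subr_gt0.
pose b1 := (b + b0) / 2.
have bb1 : b < b1 by rewrite /b1; lra.
have b1b0 : b1 < b0 by rewrite /b1; lra.
have a0b1 : a0 < b1 by lra.
have [c1 [z1 [c1E Cz1 z1max]]] :=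
  @exists_max_rectangle b1 b1 x (fun=> 0) a0b1 (lexx b1) b1b0 Cx (@cst_continuous _ _ _).
have {}z1max z : C z -> f (b1, z) <= f (b1, z1).
  have -> : b1 = c1 by lra.
  by move=> Cz; have := z1max b1 z; rewrite lexx !subr0 => /(_ erefl Cz);
     have -> : b1 = c1 by lra.
(* The quadratic penalty past [b] keeps the maximum away from [b1]. *)
pose k := (`|f (b1, z1) - f (b, x) - s * (b1 - b)| + 1) / (b1 - b) ^+ 2.
have k0 : 0 <= k by rewrite divr_ge0 ?sqr_ge0 // addr_ge0.
pose g (r : R) := s * (r - a) + k * (Num.max 0 (r - b)) ^+ 2.
have cg : continuous g.
  move=> r; apply: cvgD.
    apply: cvgM; first exact: cvg_cst.
    by apply: cvgB; [exact: cvg_id|exact: cvg_cst].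
  apply: cvgM; first exact: cvg_cst.
  apply: (@continuous_comp _ _ _ (fun r => Num.max 0 (r - b)) (fun r => r ^+ 2));
    last exact: exprn_continuous.
  apply: continuous_max; first exact: cvg_cst.
  by apply: cvgB; [exact: cvg_id|exact: cvg_cst].
have [|r [w [/andP[ar rb1] Cw wmax]]] := @exists_max_rectangle a b1 x g a0a _ b1b0 Cx cg.
  by lra.
have := wmax b x; rewrite {1 2}/g subrr max_l // expr0n /= mulr0 addr0.
have -> : a <= b <= b1 by lra.
move=> /(_ erefl Cx) bw.
(* At [r = a] the maximum gives the claim, at [r = b1] it contradicts the choice of [k], and in
   between [touch] bounds by [eta] the slope of [g], which is at least [s]. *)
have [ra|ra] := eqVneq r a.
  move: bw; rewrite /g ra subrr mulr0 max_l ?expr0n /=; last lra.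
  have := ymax _ Cw; lra.
have [rb|rb] := eqVneq r b1.
  move: bw; rewrite /g rb max_r; last lra.
  rewrite /k divfK; last by rewrite gt_eqF // exprn_gt0 // subr_gt0.
  have := z1max _ Cw; have := ler_norm (f (b1, z1) - f (b, x) - s * (b1 - b)); lra.
have ltar : a < r by rewrite lt_neqAle eq_sym ra.
have ltrb : r < b1 by rewrite lt_neqAle rb.
suff : s + 2 * k * Num.max 0 (r - b) <= eta.
  have : 0 <= Num.max 0 (r - b) by rewrite le_max lexx.
  nra.
apply: (@touch r w _ k (Num.min (r - a) (b1 - r))) => //; first by lra.
  by rewrite lt_min; lra.
move=> r' z; rewrite lt_min => /andP[]; rewrite !ltr_norml => h1 h2 Cz.
have := wmax r' z; have -> : a <= r' <= b1 by lra.
move=> /(_ erefl Cz).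
have := sqr_pos_part_touch (r - b) (r' - b); rewrite /g.
have -> : r' - b - (r - b) = r' - r by ring.
nra.
Qed.

End CompactParameter.
End Monotonicity.

(** * Periodic test functions *)

Section TestFunctions.
Variable R : realType.
Local Notation space := (R * R * R)%type.

Definition coord_t : expr space := @Lin R space (fst \o fst)
  (fun z => continuous_comp cvg_fst cvg_fst).
Definition coord_s : expr space := @Lin R space (snd \o fst)
  (fun z => continuous_comp cvg_fst cvg_snd).
Definition coord_x : expr space := @Lin R space snd (fun z => cvg_snd).

Definition Shift (V : normedModType R) (e : expr V) (c : R) := Add e (Const _ (- c)).
Definition Sqr (V : normedModType R) (e : expr V) := Mul e e.

(* Near its base point this dominates the quadratic with slopes [qt], [qs], [p]
   when [M] is large, but unlike the quadratic it is periodic in [x]. *)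
Definition test_expr (t s x qt qs p K M : R) : expr space :=
  let h := Shift coord_x x in
  Add (Add (Add (Mul (Const _ qt) (Shift coord_t t)) (Mul (Const _ qs) (Shift coord_s s)))
           (Mul (Const _ K) (Add (Sqr (Shift coord_t t)) (Sqr (Shift coord_s s)))))
      (Add (Mul (Const _ (p / (2 * pi))) (Sin (Mul (Const _ (2 * pi)) h)))
           (Mul (Const _ M) (Sqr (Sin (Mul (Const _ pi) h))))).

Lemma eval_test_expr (t s x qt qs p K M t' s' x' : R) :
  expr_eval (test_expr t s x qt qs p K M) (t', s', x') =
  qt * (t' - t) + qs * (s' - s) + K * ((t' - t) ^+ 2 + (s' - s) ^+ 2) +
  (p / (2 * pi) * sin (2 * pi * (x' - x)) + M * sin (pi * (x' - x)) ^+ 2).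
Proof. by rewrite /= !expr2. Qed.

Lemma test_expr_periodic (t s x qt qs p K M : R) :
  forall z, expr_eval (test_expr t s x qt qs p K M) (z + @dir_x R) =
    expr_eval (test_expr t s x qt qs p K M) z.
Proof.
move=> [[t' s'] x']; rewrite /dir_x.
rewrite (_ : _ + _ = (t', s', x' + 1)); last by congr (_, _, _); rewrite addr0.
rewrite !eval_test_expr.
have -> : 2 * pi * (x' + 1 - x) = 2 * pi * (x' - x) + pi *+ 2 :> R by ring.
have -> : pi * (x' + 1 - x) = pi * (x' - x) + pi :> R by ring.
by rewrite sinD2pi sinDpi sqrrN.
Qed.

Lemma derive_test_expr t s x qt qs p K M (a b c : R) :
  'D_(a, b, c) (expr_eval (test_expr t s x qt qs p K M)) (t, s, x) = qt * a + qs * b + p * c.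
Proof.
rewrite derive_expr /= !subrr !mulr0 cos0 sin0.
have := pi_gt0 R => h.
field; lra.
Qed.

(** Near 0, sin(pi h)^2 is at least pi^2 h^2 / 4, so the [M] term absorbs both [K * h ^+ 2] and the
    error 2 pi |p| h^2 made in replacing [p * h] by the sine. *)
Lemma test_expr_above (t s x qt qs p K : R) : exists M d : R, 0 < d /\
  forall t' s' x' : R, `|x' - x| < d ->
  qt * (t' - t) + qs * (s' - s) + p * (x' - x) +
    K * ((t' - t) ^+ 2 + (s' - s) ^+ 2 + (x' - x) ^+ 2) <=
  expr_eval (test_expr t s x qt qs p K M) (t', s', x').
Proof.
have pi0 := pi_gt0 R.
(* The radius gives pi |h| <= 1/2, where the error in [sin_near_id] is at most half of pi |h|. *)
exists (4 * (`|K| + 2 * pi * `|p|) / pi ^+ 2), (2 * pi)^-1; split.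
  by rewrite invr_gt0; lra.
move=> t' s' x'; set h := x' - x => hd.
rewrite eval_test_expr -/h.
have e1 : `|sin (pi * h)| >= pi * `|h| / 2.
  have := sin_near_id (pi * h).
  have -> : (pi * h) ^+ 2 = (pi * `|h|) ^+ 2 by rewrite !exprMn real_normK ?num_real.
  have := ler_distD 0 (sin (pi * h) - pi * h) (sin (pi * h)).
  have -> : sin (pi * h) - pi * h - sin (pi * h) = - (pi * h) by ring.
  rewrite subr0 sub0r !normrN normrM (gtr0_norm pi0).
  have : pi * `|h| <= 1 / 2.
    have : `|h| * (2 * pi) < 1 by rewrite -ltr_pdivlMr ?div1r //; lra.
    lra.
  have : 0 <= pi * `|h| by rewrite mulr_ge0 // ltW.
  move: (pi * `|h|) => w; nra.
have e2 : pi ^+ 2 / 4 * h ^+ 2 <= sin (pi * h) ^+ 2.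
  rewrite -(real_normK (num_real (sin (pi * h)))) -(real_normK (num_real h)).
  have -> : pi ^+ 2 / 4 * `|h| ^+ 2 = (pi * `|h| / 2) ^+ 2 by field.
  by apply: lerXn2r; rewrite ?nnegrE // divr_ge0 // mulr_ge0 // ltW.
have e3 : p * h <= p / (2 * pi) * sin (2 * pi * h) + 2 * pi * `|p| * h ^+ 2.
  have := sin_near_id (2 * pi * h); rewrite distrC.
  move=> /(ler_wpM2l (normr_ge0 (p / (2 * pi)))).
  rewrite -normrM => /(le_trans (ler_norm _)).
  have -> : p / (2 * pi) * (2 * pi * h - sin (2 * pi * h)) =
    p * h - p / (2 * pi) * sin (2 * pi * h) by field; lra.
  rewrite normrM [`|(2 * pi)^-1|]gtr0_norm ?invr_gt0; last lra.
  have -> : `|p| / (2 * pi) * (2 * pi * h) ^+ 2 = 2 * pi * `|p| * h ^+ 2 by field; lra.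
  lra.
have e4 : (`|K| + 2 * pi * `|p|) * h ^+ 2 <=
    4 * (`|K| + 2 * pi * `|p|) / pi ^+ 2 * sin (pi * h) ^+ 2.
  have c0 : 0 <= 4 * (`|K| + 2 * pi * `|p|) / pi ^+ 2.
    by rewrite divr_ge0 ?sqr_ge0 // mulr_ge0 // addr_ge0 // mulr_ge0 // mulr_ge0 // ltW.
  apply: le_trans (ler_wpM2l c0 e2); rewrite le_eqVlt; apply/orP; left; apply/eqP.
  by field; lra.
have := ler_wpM2r (sqr_ge0 h) (ler_norm K).
lra.
Qed.

End TestFunctions.

(** * The pendulum is Tonelli *)

Section Hamiltonian.
Variable R : realType.

Definition pendulum (z : R * R) : R := z.2 ^+ 2 - sin (pi * z.1) ^+ 2.

Definition position : expr (R * R)%type := @Lin R (R * R)%type fst (fun z => cvg_fst).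
Definition momentum : expr (R * R)%type := @Lin R (R * R)%type snd (fun z => cvg_snd).

Lemma tonelli_pendulum : tonelli pendulum.
Proof.
split.
- move=> [x p]; rewrite /pendulum /= addr0.
  by rewrite mulrDr mulr1 sinDpi sqrrN.
- have -> : pendulum =
      expr_eval (Add (Sqr momentum)
        (Mul (Const _ (-1)) (Sqr (Sin (Mul (Const _ pi) position))))).
    by apply/funext => z; rewrite /pendulum /= !expr2 mulN1r.
  exact: C2_expr.
(* For |p| > 1 and |p| > M + 1, p^2 > M |p| + |p| > M |p| + 1. *)
- move=> M; exists (Num.max 1 (M + 1)) => x p; rewrite gt_max => /andP[p1 pM].
  rewrite /pendulum /= ltr_pdivlMr; last lra.
  have : sin (pi * x) ^+ 2 <= 1 by rewrite sin2cos2; have := sqr_ge0 (cos (pi * x)); lra.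
  rewrite -(real_normK (num_real p)); nra.
- move=> x p.
  have d1 (q : R) : derive1 (fun q => pendulum (x, q)) q = 2 * q.
    rewrite derive1E /pendulum /=.
    have : is_derive q 1 (fun q : R => q ^+ 2 - sin (pi * x) ^+ 2) (2 * q).
      apply: is_derive_eq; rewrite /GRing.scale /=; ring.
    by move=> h; rewrite derive_val.
  rewrite /derive1n /= (_ : derive1 (fun q => pendulum (x, q)) = (fun q => 2 * q)); last first.
    by apply/funext => q; exact: d1.
  rewrite derive1E.
  have : is_derive p 1 (fun q : R => 2 * q) 2.
    apply: is_derive_eq; rewrite /GRing.scale /=; ring.
  by move=> h; rewrite derive_val.
Qed.

End Hamiltonian.

(** * From viscosity solutions to touching by quadratics *)

Section Touching.
Variable R : realType.
Local Notation space := (R * R * R)%type.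

(** Quadratics are convenient for comparison but not periodic in [x]; [touched_above_test] trades
    one for a periodic test function with the same first derivatives. *)
Definition touched_above (u : space -> R) (t s x qt qs p K : R) : Prop :=
  exists2 d, 0 < d & forall t' s' x' : R,
    `|t' - t| < d -> `|s' - s| < d -> `|x' - x| < d ->
    u (t', s', x') <= u (t, s, x) + (qt * (t' - t) + qs * (s' - s) + p * (x' - x)
      + K * ((t' - t) ^+ 2 + (s' - s) ^+ 2 + (x' - x) ^+ 2)).

Lemma near_space (t s x : R) (P : space -> Prop) (d : R) : 0 < d ->
  (forall t' s' x', `|t' - t| < d -> `|s' - s| < d -> `|x' - x| < d -> P (t', s', x')) ->
  \forall y \near ((t, s, x) : space), P y.
Proof.
move=> d0 h; apply/nbhs_ballP; exists d => // -[[t' s'] x'] [[/= h1 h2] h3].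
by apply: h; rewrite distrC.
Qed.

Lemma touched_above_test (u : space -> R) (t s x qt qs p K : R) :
  touched_above u t s x qt qs p K ->
  exists e : expr space,
    [/\ forall z, expr_eval e (z + @dir_x R) = expr_eval e z,
       forall a b c, 'D_(a, b, c) (expr_eval e) (t, s, x) = qt * a + qs * b + p * c &
       local_max (fun y => u y - expr_eval e y) (t, s, x)].
Proof.
move=> [d d0 h].
have [M [d' [d'0 h']]] := test_expr_above t s x qt qs p K.
exists (test_expr t s x qt qs p K M); split.
- exact: test_expr_periodic.
- move=> a b c; exact: derive_test_expr.
- apply: (@near_space _ _ _ _ (Num.min d d')); first by rewrite lt_min d0.
  move=> t' s' x'; rewrite !lt_min => /andP[h1 _] /andP[h2 _] /andP[h3 h4].
  have := h _ _ _ h1 h2 h3; have := h' t' s' x' h4.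
  rewrite [X in _ <= _ - X]eval_test_expr !subrr !mulr0 sin0 expr0n /=.
  lra.
Qed.

Lemma subsolution_touched e F (u : space -> R) t s x qt qs p K :
  viscosity_subsolution (@open_domain R) e F u -> 0 < t -> 0 < s ->
  touched_above u t s x qt qs p K ->
  qt * e.1.1 + qs * e.1.2 + p * e.2 + F (x, p) <= 0.
Proof.
move=> [_ sub] t0 s0 /touched_above_test[E [per dE max]].
have := sub _ (fun z _ => per z) (C1_expr _ E) (t, s, x) (conj t0 s0) max.
case: e {sub} => -[a b] c; rewrite !dE /=; congr (_ + F (_, _) <= _); ring.
Qed.

(** Touching [- u] from above by [E] is touching [u] from below by [- E], which reverses the sign of
    every slope. *)
Lemma supersolution_touched e F (u : space -> R) t s x qt qs p K :
  viscosity_supersolution (@open_domain R) e F u -> 0 < t -> 0 < s ->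
  touched_above (fun z => - u z) t s x qt qs p K ->
  0 <= F (x, - p) - (qt * e.1.1 + qs * e.1.2 + p * e.2).
Proof.
move=> [_ sup] t0 s0 /touched_above_test[E [per dE max]].
have dN v : 'D_v (expr_eval (Mul (Const _ (-1)) E)) (t, s, x) = - 'D_v (expr_eval E) (t, s, x).
  by rewrite !derive_expr /= mul0r add0r mulN1r.
have := sup (expr_eval (Mul (Const _ (-1)) E)) _ (C1_expr _ _) (t, s, x) (conj t0 s0).
case: e {sup} => -[a b] c; rewrite !dN !dE /= => h.
apply: le_trans (h _ _) _.
- by move=> z _; rewrite /= per.
- near=> y; rewrite /= !mulN1r !opprK.
  have : - u y - expr_eval E y <= - u (t, s, x) - expr_eval E (t, s, x) by near: y; exact: max.
  lra.
- rewrite addrC !mulr0 !add0r mulr1; lra.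
Unshelve. all: by end_near.
Qed.

(* What is kept of a solution of the system: the closed face of the domain and
   the initial datum play no role.  Touching [u] from below is touching [- u]
   from above, and [pendulum] is even in [p]. *)
Record quad_solution (u : space -> R) : Prop := {
  quad_continuous : forall t s x : R, 0 < t -> 0 < s -> {for (t, s, x), continuous u};
  quad_periodic : forall t s x : R, 0 < t -> 0 < s -> u (t, s, x + 1) = u (t, s, x);
  quad_above : forall t s x qt qs p K : R, 0 < t -> 0 < s ->
    touched_above u t s x qt qs p K ->
    qt + pendulum (x, p) <= 0 /\ qs - pendulum (x, p) <= 0;
  quad_below : forall t s x qt qs p K : R, 0 < t -> 0 < s ->
    touched_above (fun z => - u z) t s x qt qs p K ->
    qt - pendulum (x, p) <= 0 /\ qs + pendulum (x, p) <= 0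
}.

Lemma multi_time_solution_quad u0 (u : space -> R) :
  multi_time_solution (@pendulum R) (fun z => - pendulum z) u0 u -> quad_solution u.
Proof.
move=> [per _ [subH supH] [subG supG] _]; split.
- move=> t s x t0 s0; exact: (proj1 subH).
- move=> t s x t0 s0; rewrite -(per (t, s, x)); last by split; exact: ltW.
  by congr u; rewrite /dir_x; congr (_, _, _); rewrite addr0.
- move=> t s x qt qs p K t0 s0 h.
  have := subsolution_touched subH t0 s0 h; have := subsolution_touched subG t0 s0 h.
  by rewrite /dir_t /dir_s /=; split; lra.
- have even x p : pendulum (x, - p) = pendulum (x, p) :> R by rewrite /pendulum /= sqrrN.
  move=> t s x qt qs p K t0 s0 h.
  have := supersolution_touched supH t0 s0 h; have := supersolution_touched supG t0 s0 h.
  by rewrite /dir_t /dir_s /= even; split; lra.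
Qed.

Lemma continuous_at_triple (T : topologicalType) (u : space -> R) (a b c : T -> R) (z : T) :
  {for z, continuous a} -> {for z, continuous b} -> {for z, continuous c} ->
  {for (a z, b z, c z), continuous u} ->
  {for z, continuous (fun y => u (a y, b y, c y))}.
Proof.
by move=> ca cb cc; apply: cvg_comp; exact: (cvg_pair (cvg_pair ca cb) cc).
Qed.

(** Negating [u] turns the Hamiltonian into its opposite, because it is even in p, and exchanging
    the two times undoes this. Upper bounds valid for every [quad_solution] thus yield lower
    bounds. *)
Lemma quad_solution_swap (u : space -> R) :
  quad_solution u -> quad_solution (fun z => - u (z.1.2, z.1.1, z.2)).
Proof.
move=> [cu pu au bu]; split => /=.
- move=> t s x t0 s0.
  have c : {for (t, s, x), continuous (fun z : space => u (z.1.2, z.1.1, z.2))}.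
    apply: continuous_at_triple; last exact: cu.
    + by apply: (continuous_comp (f := fst) (g := snd)); [exact: cvg_fst|exact: cvg_snd].
    + by apply: (continuous_comp (f := fst) (g := fst)); exact: cvg_fst.
    + exact: cvg_snd.
  exact: (cvgN c).
- by move=> t s x t0 s0; rewrite pu.
- move=> t s x qt qs p K t0 s0 [d d0 h].
  have [|h1 h2] := bu s t x qs qt p K s0 t0; last by split.
  exists d => // t' s' x' ht hs hx; have := h s' t' x' hs ht hx => /=; lra.
- move=> t s x qt qs p K t0 s0 [d d0 h].
  have [|h1 h2] := au s t x qs qt p K s0 t0; last by split.
  exists d => // t' s' x' ht hs hx; have := h s' t' x' hs ht hx => /=; rewrite !opprK; lra.
Qed.

End Touching.

(** * Invariance along the diagonal of the two times *)

Section Diagonal.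
Variable R : realType.
Local Notation space := (R * R * R)%type.

Lemma ltr_norm_sqr (a d : R) : 0 <= d -> a ^+ 2 < d ^+ 2 -> `|a| < d.
Proof.
move=> d0; rewrite -(real_normK (num_real a)) => ad.
rewrite ltNge; apply/negP => da.
by have := lerXn2r 2 d0 (normr_ge0 a) da; rewrite leNgt ad.
Qed.

Section Tube.
Variables (u : space -> R) (t s x : R).
Hypothesis usol : quad_solution u.

(** Coordinates adapted to the diagonal: [z.1] runs along (1, 1, 0), the components of [z.2] along
    (1, -1, 0) and (0, 0, 1). *)
Definition tube (z : R * (R * R)) : R :=
  u (t + z.1 + z.2.1, s + z.1 - z.2.1, x + z.2.2).

Lemma continuous_tube z : 0 < t + z.1 + z.2.1 -> 0 < s + z.1 - z.2.1 ->
  {for z, continuous tube}.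
Proof.
move=> h1 h2.
have c1 : {for z, continuous (fun y : R * (R * R) => y.1)} by exact: cvg_fst.
have c2 : {for z, continuous (fun y : R * (R * R) => y.2.1)}.
  by apply: (continuous_comp (f := snd) (g := fst)); [exact: cvg_snd|exact: cvg_fst].
have c3 : {for z, continuous (fun y : R * (R * R) => y.2.2)}.
  by apply: (continuous_comp (f := snd) (g := snd)); exact: cvg_snd.
apply: continuous_at_triple.
- apply: cvgD; last exact: c2.
  apply: cvgD; [exact: cvg_cst|exact: c1].
- apply: cvgB; last exact: c2.
  apply: cvgD; [exact: cvg_cst|exact: c1].
- apply: cvgD; [exact: cvg_cst|exact: c3].
- exact: quad_continuous.
Qed.

End Tube.

(* Touching after a sup-convolution in the directions transverse to the
   diagonal; the slopes in [t] and [s] then add up to the slope along it. *)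
Lemma diagonal_le (u : space -> R) (t s r x : R) :
  quad_solution u -> 0 < t -> 0 < s -> 0 <= r -> u (t + r, s + r, x) <= u (t, s, x).
Proof.
move=> usol t0 s0 r0; apply/ler_addgt0Pr => e e0.
have [d1 d10 near_u] : exists2 d, 0 < d & forall t' s' x' : R,
    `|t' - t| < d -> `|s' - s| < d -> `|x' - x| < d -> u (t', s', x') <= u (t, s, x) + e.
  have /cvgrPdist_lt/(_ e e0)/nbhs_ballP[d d0 h] := @quad_continuous _ _ usol t s x t0 s0.
  exists d => // t' s' x' ht hs hx.
  have : `|u (t, s, x) - u (t', s', x')| < e.
    by apply: h; split; [split|]; rewrite /ball /= distrC.
  by rewrite ltr_norml; lra.
pose m := Num.min t s.
have m0 : 0 < m by rewrite lt_min t0.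
have mt : m <= t by rewrite ge_min lexx.
have ms : m <= s by rewrite ge_min lexx orbT.
(* [m / 4] keeps both times of the tube positive; [d1 / 2] keeps its initial section inside the
   neighbourhood of [near_u]. *)
pose del := Num.min (m / 4) (d1 / 2).
have del0 : 0 < del by rewrite lt_min; lra.
have delm : del <= m / 4 by rewrite ge_min lexx.
have deld : del <= d1 / 2 by rewrite ge_min lexx orbT.
pose C : set (R * R) := `[- del, del] `*` `[- del, del].
have CE a b : C (a, b) <-> `|a| <= del /\ `|b| <= del.
  by rewrite /C /= !in_itv /= !ler_norml; split => -[].
have C0 : C (0, 0) by rewrite CE normr0 ltW.
have cC : compact C by apply: compact_setX; exact: segment_compact.
have ct c y : - (m / 2) < c < r + 2 -> C y -> {for (c, y), continuous (tube u t s x)}.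
  case: y => a b cE; rewrite CE => -[]; rewrite !ler_norml => aE bE.
  by apply: continuous_tube => //=; lra.
have [c1 [y1 [c1E Cy1 max1]]] :=
  exists_max_rectangle (a := - (m / 4)) (b := r + 1) cC ct ltac:(lra) ltac:(lra) ltac:(lra) C0
    (@cst_continuous _ _ 0).
have ctN c y : - (m / 2) < c < r + 2 -> C y ->
    {for (c, y), continuous (fun z => - tube u t s x z)}.
  by move=> cE Cy; have := ct c y cE Cy => h; exact: (cvgN h).
have [c2 [y2 [c2E Cy2 max2]]] :=
  exists_max_rectangle (a := - (m / 4)) (b := r + 1) cC ctN ltac:(lra) ltac:(lra) ltac:(lra) C0
    (@cst_continuous _ _ 0).
(* At transverse distance [del] the penalty exceeds the oscillation of [u] on the tube by 1, so
   maxima of [f] over [C] are interior. *)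
pose N := (tube u t s x (c1, y1) - tube u t s x (c2, y2) + 1) / del ^+ 2.
have osc0 : 0 <= tube u t s x (c1, y1) - tube u t s x (c2, y2).
  by have := max1 c2 y2 ltac:(lra) Cy2; rewrite /= !subr0 subr_ge0.
have N0 : 0 <= N by rewrite divr_ge0 ?sqr_ge0 //; lra.
have Ndel : N * del ^+ 2 = tube u t s x (c1, y1) - tube u t s x (c2, y2) + 1.
  by rewrite /N divfK // gt_eqF // exprn_gt0.
pose f (z : R * (R * R)) := tube u t s x z - N * (z.2.1 ^+ 2 + z.2.2 ^+ 2).
have cf c y : - (m / 4) < c < r + 1 -> C y -> {for (c, y), continuous f}.
  move=> cE Cy.
  have h := ct c y ltac:(lra) Cy.
  have c2' : {for (c, y), continuous (fun y : R * (R * R) => y.2.1)}.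
    by apply: (continuous_comp (f := snd) (g := fst)); [exact: cvg_snd|exact: cvg_fst].
  have c3 : {for (c, y), continuous (fun y : R * (R * R) => y.2.2)}.
    by apply: (continuous_comp (f := snd) (g := snd)); exact: cvg_snd.
  apply: (cvgB h); apply: cvgM; first exact: cvg_cst.
  by apply: cvgD; apply: cvgM; [exact: c2'|exact: c2'|exact: c3|exact: c3].
have [|[a b] Cab] := @touch_monotone _ _ C f _ _ cC cf 0 _ 0 r (0, 0) ltac:(lra) r0 ltac:(lra) C0.
  move=> c [a b] q K d cE Cab d0 K0 h.
  have cc : `|c - c| < d by rewrite subrr normr0.
  have [alt blt] : `|a| < del /\ `|b| < del.
    have := h c (0, 0) cc C0; rewrite /f /= subrr expr0n /= !mulr0 !addr0.
    have := max1 c (a, b) ltac:(lra) Cab; rewrite !subr0.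
    have := max2 c (0, 0) ltac:(lra) C0; rewrite !subr0 => h2 h1 h3.
    have : N * (a ^+ 2 + b ^+ 2) < N * del ^+ 2 by rewrite Ndel; lra.
    have h5 : a ^+ 2 + b ^+ 2 < del ^+ 2.
      by rewrite ltNge; apply/negP => /(ler_wpM2l N0); lra.
    have := sqr_ge0 a; have := sqr_ge0 b => b2 a2.
    by split; apply: ltr_norm_sqr; [exact: ltW|clear -h5 b2; lra|exact: ltW|clear -h5 a2; lra].
  pose rho := Num.min d (Num.min (del - `|a|) (del - `|b|)).
  (* The increments of [c] and [a] are (T + S) / 2 and (T - S) / 2, so the chain rule gives these
     slopes. The two time slopes add up to [q], and the Hamiltonian cancels in the sum of the
     inequalities. *)
  have [] := @quad_above _ _ usol (t + c + a) (s + c - a) (x + b)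
    (q / 2 + N * a) (q / 2 - N * a) (2 * N * b) (K + N).
  - by move: Cab; rewrite CE ler_norml => -[]; lra.
  - by move: Cab; rewrite CE ler_norml => -[]; lra.
  - exists rho; first by rewrite !lt_min d0 !subr_gt0 alt.
    move=> t' s' x'; rewrite /rho !lt_min !ltr_norml.
    set T := t' - _; set S := s' - _; set X := x' - _.
    move=> /and3P[h1 h2 h3] /and3P[h4 h5 h6] /and3P[h7 h8 h9].
    have := h (c + (T + S) / 2) (a + (T - S) / 2, b + X).
    rewrite CE (_ : c + _ - c = (T + S) / 2); last by ring.
    have n1 : `|(T + S) / 2| < d by rewrite ltr_norml; clear -h1 h4; lra.
    have n2 : `|a + (T - S) / 2| <= del.
      by apply: le_trans (ler_normD _ _) _; rewrite -lerBrDl ler_norml; clear -h2 h5; lra.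
    have n3 : `|b + X| <= del.
      by apply: le_trans (ler_normD _ _) _; rewrite -lerBrDl ler_norml; clear -h9; lra.
    move=> /(_ n1 (conj n2 n3)); rewrite /f /tube /=.
    rewrite (_ : t + _ + _ = t'); last by rewrite /T /S; field.
    rewrite (_ : s + _ - _ = s'); last by rewrite /T /S; field.
    rewrite (_ : x + (b + X) = x'); last by rewrite /X; ring.
    have k1 : 0 <= K * (T - S) ^+ 2 by rewrite mulr_ge0 ?sqr_ge0.
    have k2 : 0 <= K * X ^+ 2 by rewrite mulr_ge0 ?sqr_ge0.
    have k3 : 0 <= N * (T + S) ^+ 2 by rewrite mulr_ge0 ?sqr_ge0.
    have k4 : 0 <= K * (T ^+ 2 + S ^+ 2) by rewrite mulr_ge0 ?addr_ge0 ?sqr_ge0.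
    have k5 : 0 <= N * (T ^+ 2 + S ^+ 2) by rewrite mulr_ge0 ?addr_ge0 ?sqr_ge0.
    clear -k1 k2 k3 k4 k5; lra.
  - lra.
rewrite /f /tube /= mul0r !addr0 subr0 expr0n /= addr0 mulr0 subr0.
move/le_trans; apply.
have := near_u (t + a) (s - a) (x + b).
have := Cab; rewrite CE => -[ad bd].
have lt_d1 (z : R) : `|z| <= del -> `|z| < d1 by clear -d10 deld; lra.
have e1 : t + a - t = a by ring.
have e2 : s - a - s = - a by ring.
have e3 : x + b - x = b by ring.
rewrite e1 e2 e3 normrN => /(_ (lt_d1 _ ad) (lt_d1 _ ad) (lt_d1 _ bd)).
have : 0 <= N * (a ^+ 2 + b ^+ 2) by rewrite mulr_ge0 ?addr_ge0 ?sqr_ge0.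
lra.
Qed.

(** The reverse inequality is [diagonal_le] for the swapped solution. *)
Lemma diagonal_invariant (u : space -> R) (t s r x : R) :
  quad_solution u -> 0 < t -> 0 < s -> 0 <= r -> u (t + r, s + r, x) = u (t, s, x).
Proof.
move=> usol t0 s0 r0; apply/le_anti; rewrite diagonal_le //=.
by have := diagonal_le x (quad_solution_swap usol) s0 t0 r0; rewrite /= lerN2.
Qed.

(** The slice s = 1 carries the function w of the overview: u(r, 1, x) = w(r - 1, x). The last
    hypothesis places the point of the slice in the open domain. *)
Lemma diagonal_slice (u : space -> R) (t s x : R) :
  quad_solution u -> 0 < t -> 0 < s -> 0 < t - s + 1 ->
  u (t, s, x) = u (t - s + 1, 1, x).
Proof.
move=> usol t0 s0 ts0; have [s1|s1] := leP 1 s.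
- rewrite -(@diagonal_invariant _ (t - s + 1) 1 (s - 1)) ?subr_ge0 //.
  by congr (u (_, _, _)); ring.
- rewrite -(@diagonal_invariant _ t s (1 - s)) ?subr_ge0 // ?ltW //.
  by congr (u (_, _, _)); ring.
Qed.

End Diagonal.

(** * Maxima on the slice s = 1 *)

Section Slice.
Variable R : realType.
Local Notation space := (R * R * R)%type.
Variable u : space -> R.
Hypothesis usol : quad_solution u.

(** Since [u] depends on t - s only, touching on the slice gives slopes [q] and [- q] in the two
    times; the two inequalities are then opposite, whence equality. The constant doubles because (T
    - S)^2 <= 2 (T^2 + S^2). *)
Lemma slice_touched (r x q p K d : R) : 0 < r -> 0 < d -> 0 <= K ->
  (forall r' x', `|r' - r| < d -> `|x' - x| < d ->
     u (r', 1, x') <= u (r, 1, x) + q * (r' - r) + p * (x' - x)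
       + K * ((r' - r) ^+ 2 + (x' - x) ^+ 2)) ->
  q + pendulum (x, p) = 0.
Proof.
move=> r0 d0 K0 h.
have [||h1 h2] := @quad_above _ _ usol r 1 x q (- q) p (2 * K) r0; [by []| |lra].
(* These radii keep the time on the slice positive and within [d] of [r], and keep [s] positive. *)
exists (Num.min (d / 2) (Num.min (r / 4) (1 / 2))).
  by rewrite !lt_min; lra.
move=> t s y; rewrite !lt_min !ltr_norml => /and3P[t1 t2 t3] /and3P[s1 s2 s3] /and3P[y1 _ _].
rewrite (@diagonal_slice _ u t s) //; try lra.
have := h (t - s + 1) y; rewrite !ltr_norml.
have -> : t - s + 1 - r = (t - r) - (s - 1) by ring.
move=> /(_ ltac:(lra) ltac:(lra)).
have k1 : 0 <= K * ((t - r) + (s - 1)) ^+ 2 by rewrite mulr_ge0 ?sqr_ge0.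
have k2 : 0 <= K * (y - x) ^+ 2 by rewrite mulr_ge0 ?sqr_ge0.
move: (t - r) (s - 1) (y - x) k1 k2 => T S X; lra.
Qed.

(** Moving to the period around 0 does not increase x^2, hence does not decrease u - k x^2 for k >=
    0. A maximum over one closed period is therefore a maximum over the line, even at an end
    point. *)
Lemma slice_representative (x : R) :
  exists y, [/\ `|y| <= 1 / 2, y ^+ 2 <= x ^+ 2 &
    forall r, 0 < r -> u (r, 1, x) = u (r, 1, y)].
Proof.
have pn (n : nat) r y : 0 < r -> u (r, 1, y + n%:R) = u (r, 1, y).
  move=> r0; elim: n => [|n IH]; first by rewrite addr0.
  by rewrite -natr1 addrA (quad_periodic usol).
have pz (n : int) r y : 0 < r -> u (r, 1, y + n%:~R) = u (r, 1, y).
  move=> r0; case: n => n; first exact: pn.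
  by rewrite NegzE mulrNz -(pn n.+1 r (y - n.+1%:R)) // subrK.
pose n := Num.floor (x + 1 / 2); pose y := x - n%:~R.
have /andP[n1 n2] := floor_itv (x + 1 / 2).
rewrite -/n intrD in n1 n2.
have yE : - (1 / 2) <= y <= 1 / 2 by rewrite /y; lra.
exists y; split; first by rewrite ler_norml.
- have [n0|n0|n0] := ltgtP n 0.
  + have : n%:~R <= -1 :> R by rewrite -[-1]/(- 1%:~R) -mulrNz ler_int -ltzD1.
    by rewrite /y in yE *; nra.
  + have : 1 <= n%:~R :> R by rewrite ler1z -gtz0_ge1.
    by rewrite /y in yE *; nra.
  + by rewrite /y n0 subr0.
- by move=> r r0; rewrite -{1}(subrK n%:~R x) pz.
Qed.

(** Its maximum over one period at time [r] is A_k(r - 1) in the notation of the overview. *)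
Definition parabola_gap (k : R) (z : R * R) : R := u (z.1, 1, z.2) - k * z.2 ^+ 2.

Let C : set R := `[- (1 / 2), 1 / 2].

Let CE y : C y <-> `|y| <= 1 / 2.
Proof. by rewrite /C /= in_itv /= ler_norml. Qed.

Lemma continuous_parabola_gap (k c y : R) : 0 < c ->
  {for (c, y), continuous (parabola_gap k)}.
Proof.
move=> c0.
have h : {for (c, y), continuous (fun z : R * R => u (z.1, 1, z.2))}.
  apply: continuous_at_triple; [exact: cvg_fst|exact: cvg_cst|exact: cvg_snd|].
  exact: quad_continuous.
have h2 : {for (c, y), continuous (fun z : R * R => z.2)} by exact: cvg_snd.
by apply: (cvgB h); apply: cvgM; [exact: cvg_cst|apply: cvgM; exact: h2].
Qed.

(** On the slice, [u] is touched in x with slope [2 * k * y], the derivative of the parabola, so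
    [slice_touched] determines [q]. The touching extends beyond [C] by [slice_representative], so
    end points need no separate treatment. *)
Lemma parabola_gap_touched (k r y q K d : R) :
  0 <= k -> 0 < r -> 0 < d -> 0 <= K ->
  (forall r' z, `|r' - r| < d -> C z ->
     parabola_gap k (r', z) <= parabola_gap k (r, y) + q * (r' - r) + K * (r' - r) ^+ 2) ->
  q = sin (pi * y) ^+ 2 - (2 * k * y) ^+ 2.
Proof.
move=> k0 r0 d0 K0 h.
have : q + pendulum (y, 2 * k * y) = 0.
  apply: (@slice_touched r y q _ (K + k) (Num.min d r)) => //.
  - by rewrite lt_min d0.
  - exact: addr_ge0.
  move=> r' x'; rewrite lt_min => /andP[h1]; rewrite ltr_norml => h2 _.
  have [z [zC zx E]] := slice_representative x'.
  have := h r' z h1; rewrite CE => /(_ zC); rewrite /parabola_gap /= -E; last lra.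
  have := ler_wpM2l k0 zx.
  have : 0 <= K * (x' - y) ^+ 2 by rewrite mulr_ge0 ?sqr_ge0.
  have : 0 <= k * (r' - r) ^+ 2 by rewrite mulr_ge0 ?sqr_ge0.
  lra.
rewrite /pendulum /=; lra.
Qed.

(** The slope is sin(pi y)^2 - (4 y)^2 <= 0, since |sin(pi y)| <= pi |y| and pi <= 4; hence the
    choice [k = 2]. *)
Lemma parabola_gap_nonincreasing (a b x : R) : 0 < a -> a <= b -> C x ->
  exists2 y, C y & parabola_gap 2 (b, x) <= parabola_gap 2 (a, y).
Proof.
move=> a0 ab Cx.
have [||y Cy] := @touch_monotone _ _ C (parabola_gap 2) 0 (b + 1)
  (@segment_compact _ _ _) _ 0 _ a b x a0 ab ltac:(lra) Cx.
- move=> c y /andP[c0 _] _; exact: continuous_parabola_gap.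
- move=> c y q K d /andP[c0 _] Cy d0 K0 /(parabola_gap_touched _ c0 d0 K0) -> //.
  have := sin_lipschitz (pi * y) 0; rewrite sin0 !subr0 => h.
  have h2 := lerXn2r 2 (normr_ge0 _) (normr_ge0 _) h.
  rewrite !real_normK ?num_real // in h2.
  have : pi ^+ 2 <= 16 :> R.
    have := pi_gt0 R; have := pihalf_02 R; nra.
  move=> /(ler_wpM2r (sqr_ge0 y)); lra.
by rewrite mul0r addr0; exists y.
Qed.

(** [touch_monotone] bounds growth from above, so it is applied in reversed time with rate [- eta].
    Its touching points are maximum points of the slice, where the lower bound on the squared sine
    is assumed. *)
Lemma max_growth (T eta a b x : R) : 0 <= T ->
  (forall r y, T < r -> C y -> (forall z, C z -> u (r, 1, z) <= u (r, 1, y)) ->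
     eta <= sin (pi * y) ^+ 2) ->
  T < a -> a <= b -> C x ->
  exists2 y, C y & u (a, 1, x) + eta * (b - a) <= u (b, 1, y).
Proof.
move=> T0 h Ta ab Cx.
have gE r z : parabola_gap 0 (r, z) = u (r, 1, z) by rewrite /parabola_gap mul0r subr0.
have [||y Cy] := @touch_monotone _ _ C (fun z => parabola_gap 0 (- z.1, z.2)) (- (b + 1)) (- T)
  (@segment_compact _ _ _) _ (- eta) _ (- b) (- a) x ltac:(lra) ltac:(lra) ltac:(lra) Cx.
- move=> c y cE Cy.
  apply: (@continuous_comp _ _ _ (fun z : R * R => (- z.1, z.2)) (parabola_gap 0)).
    have n1 : {for (c, y), continuous (fun z : R * R => - z.1)}.
      have n0 : {for (c, y), continuous (fun z : R * R => z.1)} by exact: cvg_fst.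
      exact: (cvgN n0).
    have n2 : {for (c, y), continuous (fun z : R * R => z.2)} by exact: cvg_snd.
    exact: (cvg_pair n1 n2).
  by apply: continuous_parabola_gap => /=; lra.
- move=> c y q K d cE Cy d0 K0 /= htouch.
  suff : eta <= - q by lra.
  have -> : - q = sin (pi * y) ^+ 2 - (2 * 0 * y) ^+ 2.
    apply: (@parabola_gap_touched 0 (- c) y _ K d) => //; first by lra.
    move=> r z hr Cz.
    have := htouch (- r) z; rewrite opprK (_ : - r - c = - (r - - c)); last by ring.
    by rewrite normrN sqrrN mulrN mulNr => /(_ hr Cz).
  rewrite mulr0 mul0r expr0n subr0.
  apply: (h (- c)) => //; first by lra.
  move=> z Cz; have := htouch c z; rewrite subrr normr0 !gE => /(_ d0 Cz).
  by rewrite expr0n /= !mulr0 !addr0.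
rewrite /= !opprK !gE => h1; exists y => //; lra.
Qed.

Lemma slice_le_parabola_max (r0 r x y0 : R) : 0 < r0 -> 0 < r -> C x ->
  (forall z, C z -> parabola_gap 2 (r0, z) <= parabola_gap 2 (r0, y0)) ->
  u (r, 1, x) <= parabola_gap 2 (r0, y0).
Proof.
move=> r00 r10 Cx y0max; rewrite leNgt; apply/negP => lt_gap.
set A := parabola_gap 2 (r0, y0) in lt_gap y0max.
have bound r' z : r0 <= r' -> C z -> u (r', 1, z) - 2 * z ^+ 2 <= A.
  move=> r0r' Cz; have [w Cw] := parabola_gap_nonincreasing r00 r0r' Cz.
  by move=> /le_trans; apply; exact: y0max.
have [eta eta0 sin_ge] := @sin_sqr_bounded_below R ((u (r, 1, x) - A) / 2) ltac:(lra).
pose T := Num.max r r0.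
have rT : r <= T by rewrite le_max lexx.
have r0T : r0 <= T by rewrite le_max lexx orbT.
(* At such a maximum point, monotonicity of the maximum gives a value at least [u (r, 1, x)], while
   [bound] gives at most A + 2 y^2. So y^2 is at least half the gap. *)
have grow r' y : T < r' -> C y -> (forall z, C z -> u (r', 1, z) <= u (r', 1, y)) ->
    eta <= sin (pi * y) ^+ 2.
  move=> Tr' Cy ymax; apply: sin_ge; first exact/CE.
  have [||z Cz] := @max_growth 0 0 r r' x (lexx 0) _ r10 _ Cx.
  - by move=> *; exact: sqr_ge0.
  - lra.
  have := ymax z Cz; have := bound r' y ltac:(lra) Cy; lra.
have C0 : C 0 by rewrite CE normr0; lra.
(* By time [b] the maximum would reach at least A + 1, whereas [bound] allows at most A + 1/2. *)
pose b := T + 1 + (`|A - u (T + 1, 1, 0)| + 1) / eta.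
have Tb : T + 1 <= b by rewrite lerDl divr_ge0 ?addr_ge0 // ltW.
have [||z Cz] := max_growth _ grow _ Tb C0; [lra|lra|].
have -> : eta * (b - (T + 1)) = `|A - u (T + 1, 1, 0)| + 1.
  by rewrite /b; field; lra.
have := bound b z ltac:(lra) Cz.
have : z ^+ 2 <= 1 / 4.
  move: Cz; rewrite CE => /(lerXn2r 2 (normr_ge0 _)) => /(_ ltac:(rewrite nnegrE; lra)).
  rewrite real_normK ?num_real //; lra.
have := ler_norm (A - u (T + 1, 1, 0)); lra.
Qed.

Lemma slice_le_center (r0 r x : R) : 0 < r0 -> 0 < r -> u (r, 1, x) <= u (r0, 1, 0).
Proof.
move=> r00 r10; have [y [yC _ ->]] := slice_representative x => //.
have C0 : C 0 by rewrite CE normr0; lra.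
have cont c z : 0 < c < r0 + 1 -> C z -> {for (c, z), continuous (parabola_gap 2)}.
  by move=> /andP[c0 _] _; exact: continuous_parabola_gap.
have [c [y0 [cE Cy0 h]]] := exists_max_rectangle (@segment_compact _ _ _) cont
  r00 (lexx r0) ltac:(lra) C0 (@cst_continuous _ _ 0).
have y0max z : C z -> parabola_gap 2 (r0, z) <= parabola_gap 2 (r0, y0).
  have cr : c = r0 by lra.
  by move=> Cz; have := h r0 z; rewrite cr !subr0 lexx => /(_ erefl Cz).
have le_gap r' z : 0 < r' -> C z -> u (r', 1, z) <= u (r0, 1, y0) - 2 * y0 ^+ 2.
  by move=> ? ?; exact: (@slice_le_parabola_max r0 r' z y0).
(* At time [r0] and point [y0], [le_gap] bounds a value by itself minus 2 y0^2. *)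
have y00 : y0 = 0.
  apply/eqP; rewrite -sqrf_eq0 eq_le sqr_ge0 andbT.
  have := le_gap r0 y0 r00 Cy0; lra.
have := le_gap r y r10; rewrite CE y00 expr0n mulr0 subr0; exact.
Qed.

End Slice.

(** * Nonexistence of solutions for the pendulum *)

Theorem corollary2p4 (R : realType) :
  exists H : R * R -> R,
    tonelli H /\
    forall u0 : R -> R,
      periodic u0 1 -> lipschitz u0 ->
      ~ exists u : R * R * R -> R,
          multi_time_solution H (fun z => - H z) u0 u.
Proof.
exists (@pendulum R); split; first exact: tonelli_pendulum.
move=> u0 _ _ [u /multi_time_solution_quad usol].
(* For the swapped solution, [slice_le_center] makes x = 0 a minimum point of [u] as well. *)
have lower : u (1, 1, 0) <= u (1, 1, 1 / 2).
  have := slice_le_center (quad_solution_swap usol) (1 / 2) ltr01 ltr01.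
  by rewrite /= lerN2.
have upper t s x : `|t - 1| < 1 / 2 -> `|s - 1| < 1 / 2 -> u (t, s, x) <= u (1, 1, 0).
  rewrite !ltr_norml => ht hs; rewrite diagonal_slice //; [|lra..].
  by apply: slice_le_center => //; lra.
(* By [upper] and [lower], (1, 1, 1/2) is a local maximum of [u]. It is touched with zero slopes,
   and the second inequality reads 1 <= 0. *)
have [|_] := @quad_above _ _ usol 1 1 (1 / 2) 0 0 0 0 ltr01 ltr01.
  exists (1 / 2); first by lra.
  move=> t s x ht hs _; rewrite !mul0r !addr0.
  exact: le_trans (upper t s x ht hs) lower.
have -> : pendulum (1 / 2, 0) = -1 :> R.
  by rewrite /pendulum /= mul1r sin_pihalf expr0n expr1n sub0r.
lra.
Qed.
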